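(* Let $p$ be an odd prime, let $q\in\mathbb{C}_p$ with $q\neq 1$ and $|1-q|_p<p^{-1/(p-1)}$, let $x\in\mathbb{Z}_p$, and let $t$ be a formal variable. Let $n\ge 1$ and let $w_1,\dots,w_n\in\mathbb{N}$ be positive integers with $w_1\equiv w_2\equiv\cdots\equiv w_n\equiv 1\pmod 2$. For $\sigma\in S_n$ put $W_\sigma=\prod_{j=1}^{n-1}w_{\sigma(j)}$ and, for integers $k_1,\dots,k_{n-1}$, put $$K_\sigma(k_1,\dots,k_{n-1})=\sum_{j=1}^{n-1}\Big(\prod_{\substack{1\le i\le n-1\\ i\ne j}}w_{\sigma(i)}\Big)k_j .$$ Then the power series in $t$ $$\frac{1}{[2]_{q^{W_\sigma}}}\sum_{k_1=0}^{w_{\sigma(1)}-1}\cdots\sum_{k_{n-1}=0}^{w_{\sigma(n-1)}-1}(-1)^{k_1+\cdots+k_{n-1}}\,q^{w_{\sigma(n)}K_\sigma(k_1,\dots,k_{n-1})}\int_{\mathbb{Z}_p}e^{\left[W_\sigma y+\left(\prod_{j=1}^{n}w_j\right)x+w_{\sigma(n)}K_\sigma(k_1,\dots,k_{n-1})\right]_q t}\,d\mu_{-q^{W_\sigma}}(y)$$ is the same for every $\sigma\in S_n$.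
   Context: $\mathbb{Z}_p$ is the ring of $p$-adic integers and $\mathbb{C}_p$ is the completion of an algebraic closure of $\mathbb{Q}_p$, with norm normalized by $|p|_p=1/p$. $S_n$ is the symmetric group on $\{1,\dots,n\}$. For $q\in\mathbb{C}_p$ with $q\ne1$ and $|1-q|_p<p^{-1/(p-1)}$, and $z\in\mathbb{Z}_p$, write $q^z=\exp(z\log q)$ and $[z]_q=\frac{1-q^z}{1-q}$. (For a positive integer $W$, $q^W$ again satisfies $q^W\neq1$ and $|1-q^W|_p<p^{-1/(p-1)}$.) Fermionic $p$-adic $q$-integral: for such $Q\in\mathbb{C}_p$ and a continuous $f:\mathbb{Z}_p\to\mathbb{C}_p$, $$\int_{\mathbb{Z}_p}f(y)\,d\mu_{-Q}(y)=\lim_{N\to\infty}\frac{1+Q}{1+Q^{p^N}}\sum_{y=0}^{p^N-1}f(y)(-Q)^y .$$ The integral of $e^{g(y)t}=\sum_{m\ge0}g(y)^m\frac{t^m}{m!}$ is taken coefficientwise in $t$. Empty products equal $1$, empty sums equal $0$; when $n=1$ the iterated sum over the $k_j$ consists of a single term. *)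

(* Defs.v *)
From HB Require Import structures.
From mathcomp Require Import all_boot all_order all_algebra all_fingroup.
From mathcomp Require Import all_classical all_reals all_analysis.

Set Implicit Arguments.
Unset Strict Implicit.
Unset Printing Implicit Defensive.

Import Order.TTheory GRing.Theory Num.Theory.
Local Open Scope classical_set_scope.
Local Open Scope ring_scope.

(* MathComp's own norms cannot be used for a non-Archimedean absolute value,
   since they satisfy `|x *+ n| = `|x| *+ n. *)
HB.mixin Record Field_hasUltrametricAbs (R : realType) K of GRing.Field K := {
  vabs : K -> R;
  vabs_ge0 : forall x, 0 <= vabs x;
  vabs0_eq0 : forall x, vabs x = 0 -> x = 0;
  vabs0 : vabs 0 = 0;
  vabsM : forall x y : K, vabs (x * y) = vabs x * vabs y;
  vabsD_max : forall x y : K, vabs (x + y) <= Num.max (vabs x) (vabs y)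
}.

#[short(type="ultraFieldType")]
HB.structure Definition UltraField (R : realType) :=
  { K of GRing.Field K & Field_hasUltrametricAbs R K }.

Section UltraFieldMetric.
Variables (R : realType) (K : ultraFieldType R).
Implicit Types x y z : K.

Lemma vabs1 : vabs (1 : K) = 1.
Proof.
have /eqP : vabs (1 : K) * vabs (1 : K) = vabs (1 : K) * 1.
  by rewrite -vabsM !mulr1.
rewrite -subr_eq0 -mulrBr mulf_eq0 subr_eq0 => /orP[/eqP/vabs0_eq0/eqP|/eqP//].
by rewrite oner_eq0.
Qed.

Lemma vabsN x : vabs (- x) = vabs x.
Proof.
suff vN1 : vabs (-1 : K) = 1 by rewrite -mulN1r vabsM vN1 mul1r.
apply/eqP; rewrite -[_ == 1](@eqrXn2 _ 2) ?vabs_ge0 //.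
by rewrite expr2 -vabsM mulrNN mulr1 vabs1 expr1n.
Qed.

Let dist x y := vabs (x - y).

Let distxx x : dist x x = 0.
Proof. by rewrite /dist subrr vabs0. Qed.

Let dist_eq x y : dist x y = 0 -> x = y.
Proof. by move/vabs0_eq0/eqP; rewrite subr_eq0 => /eqP. Qed.

Let dist_sym x y : dist x y = dist y x.
Proof. by rewrite /dist -opprB vabsN. Qed.

Let dist_triangle y x z : dist x z <= dist x y + dist y z.
Proof.
rewrite /dist -[x - z](subrKA y); apply: le_trans (vabsD_max _ _) _.
by rewrite ge_max lerDl lerDr !vabs_ge0.
Qed.

HB.instance Definition _ :=
  isMetric.Build R K distxx dist_eq dist_sym dist_triangle.

(* The library operator lim needs a default value, used for divergent
   sequences only. *)
HB.instance Definition _ := isPointed.Build K 0.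

End UltraFieldMetric.

Section PadicNumbers.
Variables (R : realType) (p : nat) (K : ultraFieldType R).
Implicit Types (q x y z Q : K).

(* When |p| = 1/p, the absolute value restricts to the p-adic one on the
   rationals, so their closure in the complete field K is the completion of
   the rationals, i.e. the field of p-adic numbers. *)
Definition padic_num : set K := closure (range (ratr : rat -> K)).

Definition padic_int : set K := [set x | padic_num x /\ vabs x <= 1].

Definition padic_alg : set K := [set x | exists P : {poly K},
  [/\ P != 0, forall i, padic_num P`_i & root P x]].

(* K is a model of C_p: the completion of an algebraic closure of the field of
   p-adic numbers. Such a K is unique up to isometric isomorphism. *)
Record is_padic_complex : Prop := IsPadicComplex {
  padic_complete : forall F : set_system K,
    ProperFilter F -> cauchy F -> cvg F;
  vabs_p : vabs (p%:R : K) = p%:R^-1;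
  padic_alg_closed : forall P : {poly K}, (1 < size P)%N ->
    (forall i, padic_alg P`_i) -> exists2 x, padic_alg x & root P x;
  padic_alg_dense : closure padic_alg = [set: K]
}.

Definition padic_exp z : K := limn (series (fun k => z ^+ k / k`!%:R)).

Definition padic_log q : K :=
  limn (series (fun k => (-1) ^+ k * (q - 1) ^+ k.+1 / k.+1%:R)).

(* q^z *)
Definition qpow q z : K := padic_exp (z * padic_log q).

(* [z]_q *)
Definition qnum q z : K := (1 - qpow q z) / (1 - q).

(* The fermionic p-adic Q-integral. Only the values of f on nonnegative
   integers occur in the limit, so f is taken to be defined on all of K. *)
Definition fermionic_int Q (f : K -> K) : K :=
  limn (fun N => (1 + Q) / (1 + Q ^+ (p ^ N)) *
                 \sum_(0 <= y < p ^ N) f y%:R * (- Q) ^+ y).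

(* Formal power series in t are represented by their coefficient sequences. *)
Definition exp_fps z : nat -> K := fun m => z ^+ m / m`!%:R.

Definition fermionic_int_fps Q (F : K -> nat -> K) : nat -> K :=
  fun m => fermionic_int Q (fun y => F y m).

End PadicNumbers.

(* The n of the source is n.+1 here: the indices 1, ..., n-1 become
   lift ord_max j for j : 'I_n, and the last index is ord_max. *)
Section SymmetricSum.
Variables (R : realType) (p : nat) (K : ultraFieldType R) (n : nat).
Variables (w : 'I_n.+1 -> nat) (s : 'S_n.+1).

Definition wperm (j : 'I_n) : nat := w (s (lift ord_max j)).

Definition Wperm : nat := (\prod_(j < n) wperm j)%N.

Definition Kperm (k : 'I_n -> nat) : nat :=
  (\sum_(j < n) (\prod_(i < n | i != j) wperm i) * k j)%N.

(* The iterated sum over k_1, ..., k_{n-1} is a single sum over the box of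
   dependent functions k with k j < wperm j. *)
Definition sym_fps (q x : K) : nat -> K := fun m =>
  let Q := qpow q Wperm%:R in
  (qnum Q 2%:R)^-1 *
  \sum_(k : {dffun forall j : 'I_n, 'I_(wperm j)})
    let wK := (w (s ord_max) * Kperm (fun j => k j))%N in
    (-1) ^+ (\sum_(j < n) k j)%N * qpow q wK%:R *
    fermionic_int_fps p Q (fun y => exp_fps
      (qnum q (Wperm%:R * y + (\prod_(j < n.+1) w j)%N%:R * x + wK%:R))) m.

End SymmetricSum.

(* Main.v *)
(* Expand [z]_q^m binomially in powers of q^z. The sum over y < p^N defining
   the integral becomes a combination of geometric sums, each with a limit as
   N grows because Q^(p^N) tends to 1; so the integral has a closed form with
   denominators 1 + Q^(i+1). With E = exp(log q), r = E^(i+1) and P the product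
   of all the w_j, the sum over the k_j in the i-th term then factors into
   geometric sums:
     sum_k (-1)^(k_1 + ... + k_(n-1)) r^(w_sigma(n) K(k)) / (1 + r^W)
       = (1 + r^P)^(n-1) / prod_j (1 + r^(P / w_j)),
   which does not involve sigma. *)
Require Import Defs.
From HB Require Import structures.
From mathcomp Require Import all_boot all_order all_algebra all_fingroup.
From mathcomp Require Import all_classical all_reals all_analysis.
From mathcomp Require Import ring zify.

Set Implicit Arguments.
Unset Strict Implicit.
Unset Printing Implicit Defensive.

Import Order.TTheory GRing.Theory Num.Theory.
Local Open Scope classical_set_scope.
Local Open Scope ring_scope.

(** * Ultrametric absolute values and limits of sequences *)

Section UltrametricField.
Variables (R : realType) (K : ultraFieldType R).
Implicit Types (x y z l : K) (u v : nat -> K).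

Lemma vabs_eq0 x : (vabs x == 0) = (x == 0).
Proof. by apply/eqP/eqP => [/vabs0_eq0|->]; rewrite ?vabs0. Qed.

Lemma vabs_gt0 x : (0 < vabs x) = (x != 0).
Proof. by rewrite lt_neqAle vabs_ge0 andbT eq_sym vabs_eq0. Qed.

Lemma vabsX x n : vabs (x ^+ n) = vabs x ^+ n.
Proof. by elim: n => [|n IHn]; rewrite ?expr0 ?vabs1// !exprS vabsM IHn. Qed.

Lemma vabsV x : vabs x^-1 = (vabs x)^-1.
Proof.
have [->|x0] := eqVneq x 0; first by rewrite invr0 vabs0 invr0.
apply: (mulfI (_ : vabs x != 0)); first by rewrite vabs_eq0.
by rewrite -vabsM !mulfV ?vabs1 ?vabs_eq0.
Qed.

Lemma vabs_distC x y : vabs (x - y) = vabs (y - x).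
Proof. by rewrite -vabsN opprB. Qed.

Lemma vabsD_le x y (b : R) : vabs x <= b -> vabs y <= b -> vabs (x + y) <= b.
Proof. by move=> xb yb; rewrite (le_trans (vabsD_max _ _))// ge_max xb. Qed.

Lemma vabsD_lt x y (b : R) : vabs x < b -> vabs y < b -> vabs (x + y) < b.
Proof. by move=> xb yb; rewrite (le_lt_trans (vabsD_max _ _))// gt_max xb. Qed.

Lemma vabs_sum_le (I : Type) (r : seq I) (P : pred I) (F : I -> K) (b : R) :
  0 <= b -> (forall i, P i -> vabs (F i) <= b) ->
  vabs (\sum_(i <- r | P i) F i) <= b.
Proof.
move=> b0 Fb; elim/big_ind : _ => [|x y|i]; rewrite ?vabs0//.
  exact: vabsD_le.
exact: Fb.
Qed.

Lemma vabs_natr_le1 n : vabs (n%:R : K) <= 1.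
Proof.
by elim: n => [|n IHn]; rewrite ?vabs0// -natr1 vabsD_le// vabs1.
Qed.

(** Isosceles triangle principle: if [x] were smaller than [y], then [y], as a sum of [x] and
    [y - x], would be smaller than itself. *)
Lemma vabs_isolated x y : vabs (x - y) < vabs y -> vabs x = vabs y.
Proof.
move=> xy; apply/eqP; rewrite eq_le; apply/andP; split.
  by rewrite -(subrK y x) vabsD_le// ltW.
rewrite leNgt; apply/negP => xlt; have := ltxx (vabs y).
by rewrite -{1}(subrK x y) vabsD_lt// -vabsN opprB.
Qed.

Lemma vcvgP u l : u @ \oo --> l <->
  forall e, 0 < e -> \forall n \near \oo, vabs (u n - l) < e.
Proof.
split=> [/metricType_numDomainType.cvgrPdist_lt ul e e0|ul].
  by have := ul e e0; apply: filterS => n; rewrite /mdist/= vabs_distC.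
apply/metricType_numDomainType.cvgrPdist_lt => e e0.
by have := ul e e0; apply: filterS => n; rewrite /mdist/= vabs_distC.
Qed.

Lemma vcvg_limn u l : u @ \oo --> l -> limn u = l.
Proof. exact/cvg_lim/metric_hausdorff. Qed.

Lemma vcvg_squeeze (b : nat -> R) u l : b @ \oo --> 0 ->
  (forall n, vabs (u n - l) <= b n) -> u @ \oo --> l.
Proof.
move=> b0 ub; apply/vcvgP => e e0.
near=> n; rewrite (le_lt_trans (ub n))// (le_lt_trans (ler_norm _))//.
by near: n; exact: cvgr0_norm_lt.
Unshelve. all: by end_near. Qed.

Lemma vcvg_cst x : (fun=> x) @ \oo --> x.
Proof.
by apply/vcvgP => e e0; near=> n; rewrite subrr vabs0.
Unshelve. all: by end_near. Qed.

Lemma vcvgD u v x y :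
  u @ \oo --> x -> v @ \oo --> y -> (fun n => u n + v n) @ \oo --> x + y.
Proof.
move=> /vcvgP ux /vcvgP vy; apply/vcvgP => e e0.
near=> n; rewrite opprD addrACA vabsD_lt//; near: n; [exact: ux|exact: vy].
Unshelve. all: by end_near. Qed.

Lemma vcvgMl x u l : u @ \oo --> l -> (fun n => x * u n) @ \oo --> x * l.
Proof.
move=> /vcvgP ul; apply/vcvgP => e e0.
have x1 : 0 < vabs x + 1 by rewrite ltr_wpDl ?vabs_ge0.
near=> n; rewrite -mulrBr vabsM.
rewrite (@le_lt_trans _ _ ((vabs x + 1) * vabs (u n - l)))//.
  by rewrite ler_wpM2r ?vabs_ge0// lerDl.
rewrite mulrC -ltr_pdivlMr//; near: n; apply: ul; exact: divr_gt0.
Unshelve. all: by end_near. Qed.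

Lemma vcvgM u v x y :
  u @ \oo --> x -> v @ \oo --> y -> (fun n => u n * v n) @ \oo --> x * y.
Proof.
move=> ux vy.
suff uv0 : (fun n => (u n - x) * (v n - y)) @ \oo --> 0.
  have -> : (fun n => u n * v n) = (fun n =>
      (u n - x) * (v n - y) + (y * u n + x * v n - x * y)).
    by apply/funext => n; ring.
  have := vcvgD uv0 (vcvgD (vcvgD (vcvgMl (x := y) ux) (vcvgMl (x := x) vy))
    (vcvg_cst (x := - (x * y)))).
  by have -> : 0 + (y * x + x * y - x * y) = x * y by ring.
apply/vcvgP => e e0; move/vcvgP in ux; move/vcvgP in vy.
near=> n; rewrite subr0 vabsM -[ltRHS]mul1r ltr_pM ?vabs_ge0//; near: n.
  exact: ux.
exact: vy.
Unshelve. all: by end_near. Qed.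

Lemma vcvg_sum n (u : 'I_n -> nat -> K) (l : 'I_n -> K) :
  (forall i, u i @ \oo --> l i) ->
  (fun N => \sum_(i < n) u i N) @ \oo --> \sum_(i < n) l i.
Proof.
elim: n u l => [u l _|n IHn u l ul].
  rewrite big_ord0; under eq_fun do rewrite big_ord0; exact: vcvg_cst.
rewrite big_ord_recl; under eq_fun do rewrite big_ord_recl.
by apply: vcvgD => //; apply: IHn.
Qed.

(** Closed balls are closed; this carries bounds on partial sums over to sums of series. *)
Lemma vcvg_le u l y (b : R) N : u @ \oo --> l ->
  (forall n, (N <= n)%N -> vabs (u n - y) <= b) -> vabs (l - y) <= b.
Proof.
move=> /vcvgP ul uy; apply/ler_addgt0Pr => e e0.
near \oo => n; rewrite -[l - y](subrKA (u n)) (le_trans (vabsD_max _ _))//.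
rewrite ge_max; apply/andP; split.
  rewrite (@le_trans _ _ e)//; last first.
    rewrite lerDr (le_trans (vabs_ge0 (u n - y)))// uy//.
    by near: n; exact: nbhs_infty_ge.
  by rewrite vabs_distC ltW//; near: n; exact: ul.
by rewrite ler_wpDr ?(ltW e0)// uy//; near: n; exact: nbhs_infty_ge.
Unshelve. all: by end_near. Qed.

End UltrametricField.

(** * The exponent of a prime in a factorial *)

Lemma logn_fact_divn p n : prime p ->
  logn p n`! = (n %/ p + logn p (n %/ p)`!)%N.
Proof.
move=> pp; rewrite !logn_fact//; case: n => [|n].
  by rewrite div0n !big_geq.
(* In Legendre's formula the first term is [n %/ p]. The later ones are the terms of the formula for
   [n %/ p], followed by zeros. *)
rewrite big_nat_recl// expn1; congr addn.
have le_q : (n.+1 %/ p <= n)%N by rewrite -ltnS ltn_Pdiv ?prime_gt1.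
rewrite (big_cat_nat (n := (n.+1 %/ p).+1))//= [X in (_ + X)%N]big_nat_cond.
rewrite [X in (_ + X)%N]big1 ?addn0.
  by apply: eq_bigr => i _; rewrite expnS divnMA.
move=> i /andP[/andP[qi _] _]; rewrite expnS divnMA divn_small//.
by rewrite (leq_trans qi)// ltnW// ltn_expl// prime_gt1.
Qed.

Lemma logn_fact_lt p n : prime p -> (0 < n)%N -> (p.-1 * logn p n`! < n)%N.
Proof.
move=> pp; have p1 := prime_gt1 pp.
elim/ltn_ind: n => n IHn n0; rewrite logn_fact_divn//.
have [->|q0] := posnP (n %/ p); first by rewrite fact0 logn1 addn0 muln0.
have := IHn _ (ltn_Pdiv p1 n0) q0; have := leq_divM n p.
rewrite mulnDr; move: (n %/ p)%N (logn _ _) => m v; nia.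
Qed.

(** * Absolute values of integers, factorials and series coefficients *)

Section PadicAbs.
Variables (R : realType) (p : nat) (K : ultraFieldType R).
Hypotheses (p_prime : prime p) (vabs_pE : vabs (p%:R : K) = p%:R^-1).

(** By Bezout, 1 is a combination of [p] and [m]; if both had absolute value below 1, so would 1. *)
Lemma vabs_natr_coprime m : coprime p m -> vabs (m%:R : K) = 1.
Proof.
move=> pm; apply/eqP; rewrite eq_le vabs_natr_le1 leNgt /=; apply/negP => m1.
have p1 : vabs (p%:R : K) < 1.
  by rewrite vabs_pE invf_lt1 ?ltr0n ?ltr1n ?prime_gt0 ?prime_gt1.
have [a b ab _] := egcdnP m (prime_gt0 p_prime).
have := ltxx (1 : R); rewrite -{1}(vabs1 K).
have -> : 1 = a%:R * p%:R - b%:R * m%:R :> K.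
  by rewrite -!natrM ab (eqP pm) natrD addrC addKr.
suff lt1 c d : vabs (d%:R : K) < 1 -> vabs (c%:R * d%:R : K) < 1.
  by rewrite vabsD_lt ?vabsN ?lt1.
by rewrite vabsM => d1; rewrite (le_lt_trans _ d1)// ler_piMl ?vabs_ge0//
  vabs_natr_le1.
Qed.

Lemma vabs_natr n : (0 < n)%N -> vabs (n%:R : K) = p%:R ^- logn p n.
Proof.
move=> n0; have [m pm nE] := pfactor_coprime p_prime n0.
rewrite {1}nE natrM vabsM vabs_natr_coprime// mul1r natrX vabsX vabs_pE.
exact: exprVn.
Qed.

Local Notation rho := (p%:R `^ (- (p%:R - 1)^-1) : R).

Let p_gt0 : 0 < p%:R :> R. Proof. by rewrite ltr0n prime_gt0. Qed.

Lemma rho_gt0 : 0 < rho. Proof. exact: powR_gt0. Qed.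

Lemma rho_expn : rho ^+ p.-1 = p%:R^-1.
Proof.
rewrite -powR_mulrn ?powR_ge0// -powRrM -subn1 natrB ?prime_gt0//.
rewrite mulNr mulVf ?powRN ?powRr1 ?(ltW p_gt0)//.
by rewrite gt_eqF// subr_gt0 ltr1n prime_gt1.
Qed.

Lemma rho_le1 : rho <= 1.
Proof.
rewrite -[leRHS](powRr0 p%:R) ler_powR// ?ler1n ?prime_gt0// oppr_le0 invr_ge0.
by rewrite subr_ge0 ler1n prime_gt0.
Qed.

Lemma vabs_fact_ge k : rho ^+ k <= vabs (k.+1`!%:R : K).
Proof.
rewrite vabs_natr ?fact_gt0// -exprVn -rho_expn -exprM.
rewrite ler_wiXn2l ?powR_ge0 ?rho_le1// -ltnS.
exact: logn_fact_lt.
Qed.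

Lemma natr_fact_neq0 k : k`!%:R != 0 :> K.
Proof.
rewrite -vabs_gt0; case: k => [|k]; first by rewrite fact0 vabs1.
by rewrite (lt_le_trans _ (vabs_fact_ge k))// exprn_gt0 ?rho_gt0.
Qed.

Lemma natr_neq0 n : (n%:R != 0 :> K) = (0 < n)%N.
Proof.
case: n => [|n]; first by rewrite eqxx.
by have := natr_fact_neq0 n.+1; rewrite factS natrM mulf_eq0 negb_or => /andP[].
Qed.

(** One factor [vabs z] stays outside the geometric term, so that the bound also compares the tail
    of the series with [z] itself. *)
Lemma vabs_exp_coeff_le (z : K) k :
  vabs (z ^+ k.+1 / k.+1`!%:R) <= vabs z * (vabs z / rho) ^+ k.
Proof.
rewrite vabsM vabsX vabsV exprS -mulrA ler_wpM2l ?vabs_ge0//.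
rewrite exprMn ler_wpM2l ?exprn_ge0 ?vabs_ge0// exprVn lef_pV2 ?vabs_fact_ge//.
  by rewrite posrE vabs_gt0 natr_fact_neq0.
by rewrite posrE exprn_gt0 ?rho_gt0.
Qed.

Lemma vabs_log_coeff_le (z : K) k :
  vabs ((-1) ^+ k * z ^+ k.+1 / k.+1%:R) <= vabs z * (vabs z / rho) ^+ k.
Proof.
rewrite (le_trans _ (vabs_exp_coeff_le z k))// !vabsM.
rewrite [vabs ((-1) ^+ k)]vabsX vabsN vabs1.
rewrite expr1n mul1r ler_wpM2l ?vabs_ge0// !vabsV lef_pV2.
- by rewrite factS natrM vabsM ler_piMr ?vabs_ge0// vabs_natr_le1.
- by rewrite posrE vabs_gt0 natr_neq0.
- by rewrite posrE vabs_gt0 natr_fact_neq0.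
Qed.

End PadicAbs.

(** * Geometrically dominated series in a complete field, and rearrangement of double sums *)

Section PadicSeries.
Variables (R : realType) (K : ultraFieldType R).
Hypothesis K_complete :
  forall F : set_system K, ProperFilter F -> cauchy F -> cvg F.
Variables (C t : R) (u : nat -> K).
Hypotheses (t_ge0 : 0 <= t) (t_lt1 : t < 1).
(** The term [u 0] is left free: it is the main term, 1 for the exponential and [q - 1] for the
    logarithm. *)
Hypothesis u_le : forall k, vabs (u k.+1) <= C * t ^+ k.

Let C_ge0 : 0 <= C.
Proof.
by have := u_le 0; rewrite expr0 mulr1; apply: le_trans; exact: vabs_ge0.
Qed.

(** An ultrametric sum is bounded by its largest term, and the bounds decrease, so the bound for
    [u N.+1] serves the whole tail. *)
Let tail_le N n : (N < n)%N ->
  vabs (series u n - series u N.+1) <= C * t ^+ N.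
Proof.
move=> Nn; rewrite sub_series_geq// big_nat_cond vabs_sum_le//.
  by rewrite mulr_ge0// exprn_ge0.
move=> [//|k] /andP[/andP[Nk _] _]; rewrite (le_trans (u_le k))// ler_wpM2l//.
by rewrite ler_wiXn2l// ltW.
Qed.

Lemma is_cvg_ultra_series : series u @ \oo --> limn (series u).
Proof.
apply: K_complete; apply: cauchy_exP => e e0.
have : (fun N => C * t ^+ N) @ \oo --> 0.
  by apply: cvg_geometric; rewrite ger0_norm.
move=> /cvgr0_norm_lt /(_ e e0) [N _ /(_ N (leqnn N))/= Ne].
exists (series u N.+1); near=> n; rewrite /ball/= /mdist/= vabs_distC.
rewrite (le_lt_trans _ (le_lt_trans (ler_norm _) Ne))// tail_le//.
by near: n; exact: nbhs_infty_gt.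
Unshelve. all: by end_near. Qed.

Lemma ultra_series_tail N :
  vabs (limn (series u) - series u N.+1) <= C * t ^+ N.
Proof. by apply: (vcvg_le is_cvg_ultra_series) => n; exact: tail_le. Qed.

End PadicSeries.

(** Both sides run over the pairs with [i + j < n], by diagonals and by rows; this is needed for the
    Cauchy product. *)
Lemma big_triangle (V : nmodType) (F : nat -> nat -> V) n :
  \sum_(0 <= k < n) \sum_(i < k.+1) F i (k - i)%N =
  \sum_(0 <= i < n) \sum_(0 <= j < n - i) F i j.
Proof.
elim: n => [|n IHn]; first by rewrite !big_geq.
rewrite big_nat_recr//= IHn [RHS]big_nat_recr//= subSnn big_nat1.
rewrite big_ord_recr/= subnn addrA; congr (_ + _).
rewrite -(big_mkord xpredT (fun i => F i (n - i)%N)) -big_split/=.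
apply: eq_big_nat => i /andP[_ i_n].
by rewrite subSn ?(ltnW i_n)// big_nat_recr.
Qed.

(** * The p-adic exponential and logarithm *)

Section PadicExpLog.
Variables (R : realType) (p : nat) (K : ultraFieldType R).
Hypotheses (p_prime : prime p) (K_Cp : is_padic_complex p K).
Implicit Types q x y z : K.

Local Notation rho := (p%:R `^ (- (p%:R - 1)^-1) : R).

Let vabs_pE := vabs_p K_Cp.
Let rho0 : 0 < rho := rho_gt0 R p_prime.

Let ratio_ge0 z : 0 <= vabs z / rho.
Proof. by rewrite divr_ge0 ?vabs_ge0// ltW. Qed.

Let ratio_lt1 z : vabs z < rho -> vabs z / rho < 1.
Proof. by rewrite ltr_pdivrMr// mul1r. Qed.

Lemma padic_exp_cvg z : vabs z < rho ->
  series (fun k => z ^+ k / k`!%:R) @ \oo --> padic_exp z.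
Proof.
move=> z_small; apply: (is_cvg_ultra_series (padic_complete K_Cp)
  (ratio_ge0 z) (ratio_lt1 z_small)) => k.
exact: (vabs_exp_coeff_le p_prime vabs_pE).
Qed.

Let exp_tail z N : vabs z < rho ->
  vabs (padic_exp z - series (fun k => z ^+ k / k`!%:R) N.+1) <=
  vabs z * (vabs z / rho) ^+ N.
Proof.
move=> z_small; apply: (ultra_series_tail (padic_complete K_Cp)
  (ratio_ge0 z) (ratio_lt1 z_small)) => k.
exact: (vabs_exp_coeff_le p_prime vabs_pE).
Qed.

Lemma vabs_padic_exp_sub1 z : vabs z < rho -> vabs (padic_exp z - 1) <= vabs z.
Proof.
move=> /(exp_tail 0); rewrite seriesEnat/= big_nat1.
by rewrite !expr0 fact0 divr1 mulr1.
Qed.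

Lemma vabs_padic_exp_sub1D z : vabs z < rho ->
  vabs (padic_exp z - (1 + z)) <= vabs z * (vabs z / rho).
Proof.
move=> /(exp_tail 1); rewrite seriesEnat/= big_nat_recr//= big_nat1.
by rewrite !expr0 !expr1 fact0 !divr1.
Qed.

Lemma padic_exp0 : padic_exp (0 : K) = 1.
Proof.
apply/eqP; rewrite -subr_eq0 -vabs_eq0 eq_le vabs_ge0 andbT.
by rewrite -[leRHS](@vabs0 _ K) vabs_padic_exp_sub1// vabs0.
Qed.

(** The product of the two [n]-th partial sums exceeds the [n]-th partial sum for [x + y] by the
    terms [a i * b j] with [i + j >= n], and these tend to 0 uniformly. *)
Lemma padic_expD x y : vabs x < rho -> vabs y < rho ->
  padic_exp (x + y) = padic_exp x * padic_exp y.
Proof.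
move=> xs ys; pose a k := x ^+ k / k`!%:R; pose b k := y ^+ k / k`!%:R.
have fact0 k : k`!%:R != 0 :> K by exact: (natr_fact_neq0 p_prime vabs_pE).
have coeffD k : (x + y) ^+ k / k`!%:R = \sum_(i < k.+1) a i * b (k - i)%N.
  rewrite [x + y]addrC exprDn mulr_suml; apply: eq_bigr => i _.
  have ik : (i <= k)%N by rewrite -ltnS.
  rewrite -(bin_fact ik) !natrM -mulr_natr /a /b.
  have bin0 : 'C(k, i)%:R != 0 :> K.
    by rewrite (natr_neq0 p_prime vabs_pE) bin_gt0.
  have := fact0 i; have := fact0 (k - i)%N => ki0 i0; field.
  by rewrite bin0 ki0 i0.
(* A common ratio below 1 for both series. As [rho <= 1], it also bounds [vabs x] and [vabs y], so
   the [k]-th coefficients are at most [t ^+ k]. *)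
set t := Num.max (vabs x) (vabs y) / rho.
have t0 : 0 <= t by rewrite divr_ge0 ?(ltW rho0)// le_max vabs_ge0.
have t1 : t < 1 by rewrite ltr_pdivrMr// mul1r gt_max xs.
have coeff_le z k : vabs z <= Num.max (vabs x) (vabs y) ->
    vabs (z ^+ k / k`!%:R) <= t ^+ k.
  case: k => [|k] zt; first by rewrite !expr0 divr1 vabs1.
  rewrite (le_trans (vabs_exp_coeff_le p_prime vabs_pE _ _))// exprS.
  have zt' : vabs z / rho <= t by rewrite ler_wpM2r// invr_ge0 ltW.
  rewrite ler_pM ?vabs_ge0 ?exprn_ge0//.
    rewrite (le_trans zt)// ler_pdivlMr// ler_piMr//.
      by rewrite le_max vabs_ge0.
    exact: rho_le1.
  by rewrite lerXn2r ?nnegrE.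
have xy : vabs (x + y) < rho by exact: vabsD_lt.
have cvg_prod := vcvgM (padic_exp_cvg xs) (padic_exp_cvg ys).
rewrite -(vcvg_limn cvg_prod); apply/esym/vcvg_limn.
rewrite -[padic_exp (x + y)]addr0.
have -> : (fun n => series (fun k => x ^+ k / k`!%:R) n *
    series (fun k => y ^+ k / k`!%:R) n) = (fun n =>
    series (fun k => (x + y) ^+ k / k`!%:R) n +
    \sum_(0 <= i < n) \sum_(n - i <= j < n) a i * b j).
  apply/funext => n; rewrite !seriesEnat/=.
  under [in RHS]eq_bigr do rewrite coeffD.
  rewrite (big_triangle (fun i j => a i * b j)) -big_split/= mulr_suml.
  apply: eq_big_nat => i _; rewrite -big_cat_nat ?leq_subr//=.
  by rewrite mulr_sumr.
apply: vcvgD; first exact: padic_exp_cvg.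
apply: (@vcvg_squeeze _ _ (fun n => t ^+ n)) => [|n].
  by apply: cvg_expr; rewrite ger0_norm.
rewrite subr0 big_nat_cond vabs_sum_le ?exprn_ge0// => i _.
rewrite big_nat_cond vabs_sum_le ?exprn_ge0// => j /andP[/andP[nij _] _].
rewrite vabsM (@le_trans _ _ (t ^+ (i + j)))//.
  by rewrite exprD ler_pM ?vabs_ge0// coeff_le// le_max lexx ?orbT.
by rewrite ler_wiXn2l ?(ltW t1)//; rewrite leq_subLR in nij.
Qed.

Lemma vabs_natrM_lt n z : vabs z < rho -> vabs (n%:R * z) < rho.
Proof.
apply: le_lt_trans; rewrite vabsM ler_piMl ?vabs_ge0//.
exact: vabs_natr_le1.
Qed.

Lemma padic_expMn n z : vabs z < rho -> padic_exp (n%:R * z) = padic_exp z ^+ n.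
Proof.
move=> zs; elim: n => [|n IHn]; first by rewrite mul0r padic_exp0.
by rewrite -natr1 mulrDl mul1r padic_expD ?vabs_natrM_lt// IHn exprSr.
Qed.

(** If the value were 1, the remainder after the linear term would be [- z], yet it is strictly
    smaller than [z]. *)
Lemma padic_exp_neq1 z : vabs z < rho -> z != 0 -> padic_exp z != 1.
Proof.
move=> zs z0; apply/eqP => e1; have := vabs_padic_exp_sub1D zs.
rewrite e1 opprD addrA subrr sub0r vabsN leNgt gtr_pMr ?vabs_gt0//.
by rewrite ratio_lt1.
Qed.

Let log_coeff x k : K := (-1) ^+ k * x ^+ k.+1 / k.+1%:R.

Let log_coeff_le x k :
  vabs (log_coeff x k.+1) <= vabs x * (vabs x / rho) * (vabs x / rho) ^+ k.
Proof.
by rewrite -mulrA -exprS; exact: (vabs_log_coeff_le p_prime vabs_pE).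
Qed.

Lemma padic_log_cvg q : vabs (q - 1) < rho ->
  series (log_coeff (q - 1)) @ \oo --> padic_log q.
Proof.
move=> qs; exact: (is_cvg_ultra_series (padic_complete K_Cp)
  (ratio_ge0 _) (ratio_lt1 qs) (log_coeff_le _)).
Qed.

(** The leading term [q - 1] strictly dominates the rest of the series. *)
Lemma vabs_padic_log q : q != 1 -> vabs (q - 1) < rho ->
  vabs (padic_log q) = vabs (q - 1).
Proof.
move=> q1 qs; apply: vabs_isolated.
have := ultra_series_tail (padic_complete K_Cp)
  (ratio_ge0 _) (ratio_lt1 qs) (log_coeff_le _) 0.
rewrite seriesEnat/= big_nat1 expr0 mulr1 /log_coeff expr0 expr1 mul1r divr1.
move=> /le_lt_trans; apply; rewrite gtr_pMr ?ratio_lt1// vabs_gt0.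
by rewrite subr_eq0.
Qed.

(** Up to denominators [k!], ['C(n, k)] is congruent to [(-1)^k] modulo [n.+1]. Induction by
    Pascal's rule, where [k.+1 * 'C(n.+1, k.+1) = n.+1 * 'C(n, k)] controls the error. It is applied
    with [n.+1 = p ^ N]. *)
Lemma vabs_binS_sub_sign n k :
  vabs ('C(n, k)%:R - (-1) ^+ k : K) <= vabs (n.+1%:R : K) / vabs (k`!%:R : K).
Proof.
elim: k => [|k IHk].
  by rewrite bin0 expr0 subrr vabs0 fact0 vabs1 divr1 vabs_ge0.
have k0 : 0 < vabs (k.+1%:R : K).
  by rewrite vabs_gt0 (natr_neq0 p_prime vabs_pE).
have f0 : 0 < vabs (k`!%:R : K).
  by rewrite vabs_gt0 (natr_fact_neq0 p_prime vabs_pE).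
have -> : 'C(n, k.+1)%:R - (-1) ^+ k.+1 =
    'C(n.+1, k.+1)%:R - ('C(n, k)%:R - (-1) ^+ k) :> K.
  by rewrite binS natrD exprS; ring.
rewrite factS natrM vabsM; apply: vabsD_le.
  rewrite ler_pdivlMr ?mulr_gt0// mulrA -vabsM -natrM mulnC -mul_bin_diag.
  rewrite natrM vabsM -mulrA ler_piMr ?vabs_ge0// -vabsM -natrM.
  exact: vabs_natr_le1.
rewrite vabsN (le_trans IHk)// ler_wpM2l ?vabs_ge0// lef_pV2 ?posrE ?mulr_gt0//.
by rewrite ler_piMl ?vabs_ge0// vabs_natr_le1.
Qed.

(* Both [log Q] and [z] are the limit of [(Q ^ p^N - 1) / p^N] for [Q = exp z],
   the former by the binomial theorem. *)
Lemma padic_expK z : vabs z < rho -> padic_log (padic_exp z) = z.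
Proof.
move=> zs; set Q := padic_exp z; set x := Q - 1.
have p0 : 0 < p%:R :> R by rewrite ltr0n prime_gt0.
have xs : vabs x < rho by rewrite (le_lt_trans _ zs)// vabs_padic_exp_sub1.
pose d N : K := (Q ^+ (p ^ N) - 1) / (p ^ N)%:R.
have vp N : vabs ((p ^ N)%:R : K) = p%:R^-1 ^+ N by rewrite natrX vabsX vabs_pE.
have vp0 N : 0 < vabs ((p ^ N)%:R : K) by rewrite vp exprn_gt0// invr_gt0.
(* The remainder of the exponential is quadratic in [p ^ N * z], so one factor [p ^ N] survives the
   division. *)
have dz N : vabs (d N - z) <= p%:R^-1 ^+ N.
  have -> : d N - z =
      (padic_exp ((p ^ N)%:R * z) - (1 + (p ^ N)%:R * z)) / (p ^ N)%:R.
    rewrite padic_expMn// opprD addrA mulrBl -/Q; congr (_ - _).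
    by rewrite mulrAC divff ?mul1r// -vabs_gt0.
  rewrite vabsM vabsV ler_pdivrMr// -vp.
  rewrite (le_trans (vabs_padic_exp_sub1D (vabs_natrM_lt _ zs)))//.
  rewrite !vabsM -mulrA ler_wpM2l ?vabs_ge0//.
  rewrite mulrCA -mulrA ler_piMr ?vabs_ge0// -[leRHS]mulr1.
  rewrite ler_pM ?vabs_ge0 ?ratio_ge0 ?(ltW (ratio_lt1 zs))//.
  by rewrite (le_trans (ltW zs))// rho_le1.
have dlog N : vabs (series (log_coeff x) (p ^ N)%N - d N) <= p%:R^-1 ^+ N.
  have [m pN] : {m | (p ^ N = m.+1)%N}.
    by exists (p ^ N)%N.-1; rewrite prednK// expn_gt0 prime_gt0.
  (* Binomial expansion of [(1 + x) ^ p^N]; dividing ['C(p ^ N, k.+1)] by [p ^ N] leaves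
     ['C(m, k) / k.+1]. *)
  have -> : d N = \sum_(0 <= k < (p ^ N)%N) 'C(m, k)%:R * (x ^+ k.+1 / k.+1%:R).
    rewrite /d -[Q](subrK 1) -/x exprD1n big_ord_recl bin0 expr0 mulr1n.
    rewrite [1 + _]addrC addrK mulr_suml big_mkord; apply: eq_bigr => k _.
    have k0 : k.+1%:R != 0 :> K by rewrite (natr_neq0 p_prime vabs_pE).
    have P0 : (p ^ N)%:R != 0 :> K by rewrite -vabs_gt0.
    have bE : 'C((p ^ N)%N, k.+1)%:R = (p ^ N)%:R * 'C(m, k)%:R / k.+1%:R :> K.
      have -> : m = (p ^ N).-1%N by rewrite pN.
      by rewrite -natrM mul_bin_diag natrM mulrAC divff ?mul1r.
    rewrite -mulr_natr bE/=; field.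
    by rewrite P0 nat1r k0.
  rewrite seriesEnat/= -sumrB -vp big_nat_cond vabs_sum_le// => [|k _].
    exact: ltW.
  have -> : log_coeff x k - 'C(m, k)%:R * (x ^+ k.+1 / k.+1%:R) =
      - (('C(m, k)%:R - (-1) ^+ k) * (x ^+ k.+1 / k.+1%:R)).
    by rewrite /log_coeff; ring.
  rewrite vabsN vabsM (le_trans (ler_wpM2r _ (vabs_binS_sub_sign m k)))//.
    exact: vabs_ge0.
  rewrite -pN -mulrA ler_piMr ?vabs_ge0//.
  rewrite -vabsV -vabsM mulrCA -invfM -natrM mulnC -factS.
  rewrite (le_trans (vabs_exp_coeff_le p_prime vabs_pE _ _))//.
  rewrite -[leRHS]mulr1 ler_pM ?vabs_ge0 ?exprn_ge0 ?ratio_ge0//.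
    by rewrite (le_trans (ltW xs))// rho_le1.
  by rewrite exprn_ile1 ?ratio_ge0// ltW// ratio_lt1.
have pow_infty : (fun N => p ^ N)%N @ \oo --> \oo.
  apply/cvgnyPge => A; near=> N; rewrite (@leq_trans N)//.
    by near: N; exact: nbhs_infty_ge.
  by rewrite ltnW// ltn_expl// prime_gt1.
(* The logarithm is read along the subsequence of partial sums with [p ^ N] terms. *)
rewrite -(vcvg_limn (cvg_comp _ _ pow_infty (padic_log_cvg xs))).
apply: vcvg_limn; apply: (@vcvg_squeeze _ _ (fun N => p%:R^-1 ^+ N)) => [|N /=].
  by apply: cvg_expr; rewrite ger0_norm ?invr_ge0 ?ltW//
    invf_lt1 ?ltr1n ?prime_gt1.
by rewrite -[_ - z](subrKA (d N)) vabsD_le.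
Unshelve. all: by end_near. Qed.

End PadicExpLog.

(** * Factorization of alternating sums over boxes *)

Lemma sum_dffun_prod (S : comPzSemiRingType) (I : finType) (T : I -> finType)
    (F : forall i, T i -> S) :
  \sum_(f : {dffun forall i, T i}) \prod_i F i (f i) =
  \prod_i \sum_(a : T i) F i a.
Proof.
pose G i := [ffun a => F i a].
(* Through [fprod], dependent functions become functions into one tagged type, where the
   distributivity of products over sums applies. *)
transitivity (\sum_(t : fprod T) \prod_i G i (t i)).
  rewrite (reindex (@dffun_of_fprod _ T)); last first.
    exact/onW_bij/dffun_of_fprod_bij.
  by apply: eq_bigr => t _; apply: eq_bigr => i _; rewrite !ffunE.
transitivity (\prod_i \sum_(u in tagged_with T i) untag 0 (G i) u).
  by rewrite big_fprod; apply/esym/bigA_distr_big_dep.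
apply: eq_bigr => i _; rewrite -(big_tag (fun i a => G i a)).
by apply: eq_bigr => a _; rewrite ffunE.
Qed.

(** Geometric sum of ratio [- a]; oddness of [n] turns [1 - (- a) ^+ n] into [1 + a ^+ n]. It serves
    both the [w j] and [p ^ N]. *)
Lemma sum_oppr_exp (F : fieldType) (a : F) n : odd n -> 1 + a != 0 ->
  \sum_(k < n) (- a) ^+ k = (1 + a ^+ n) / (1 + a).
Proof.
move=> n_odd a0; have := subrX1 (- a) n; rewrite exprNn -signr_odd n_odd.
rewrite expr1 mulN1r -!opprD mulNr => /oppr_inj.
by rewrite ![_ + 1]addrC => ->; rewrite mulrC mulKf.
Qed.

Section SymmetricGeometricSum.
Variables (F : fieldType) (n : nat) (w : 'I_n.+1 -> nat).
Hypotheses (w_gt0 : forall j, (0 < w j)%N) (w_odd : forall j, odd (w j)).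

Lemma sym_geometric_sum (r : F) (s : 'S_n.+1) : (forall a, 1 + r ^+ a != 0) ->
  \sum_(k : {dffun forall j : 'I_n, 'I_(wperm w s j)})
     (-1) ^+ (\sum_(j < n) k j)%N *
     r ^+ (w (s ord_max) * Kperm w s (fun j => k j))%N / (1 + r ^+ Wperm w s) =
  (1 + r ^+ (\prod_j w j)%N) ^+ n /
  \prod_j (1 + r ^+ ((\prod_i w i) %/ w j)%N).
Proof.
move=> r0; set P := (\prod_j w j)%N.
have PE : P = (w (s ord_max) * Wperm w s)%N.
  by rewrite /P (reindex_inj (@perm_inj _ s)) (bigD1_ord ord_max).
(* These are the coefficients of [k j] in [w (s ord_max) * Kperm w s k], which makes the summand a
   product over [j]. *)
have Pj j : (P %/ wperm w s j =
    w (s ord_max) * \prod_(i < n | i != j) wperm w s i)%N.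
  rewrite PE /Wperm (bigD1 j)//= mulnCA mulKn//; exact: w_gt0.
(* [Wperm] is [P] divided by [w (s ord_max)], so the denominator [1 + r ^+ Wperm w s] supplies the
   missing factor of a product over all indices. *)
have -> : \prod_j (1 + r ^+ (P %/ w j)%N) =
    (1 + r ^+ Wperm w s) * \prod_(j < n) (1 + r ^+ (P %/ wperm w s j)%N).
  rewrite (reindex_inj (@perm_inj _ s)) (bigD1_ord ord_max)//=.
  by rewrite {1}PE mulKn.
rewrite -mulr_suml invfM [RHS]mulrCA [RHS]mulrC; congr (_ * _).
transitivity (\prod_(j < n) \sum_(a < wperm w s j)
    (- r ^+ (P %/ wperm w s j)%N) ^+ a).
  rewrite -sum_dffun_prod; apply: eq_bigr => k _.
  rewrite /Kperm big_distrr/= -!prodrXr -big_split/=.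
  by apply: eq_bigr => j _; rewrite mulnA -Pj [in RHS]exprNn exprM.
transitivity (\prod_(j < n) ((1 + r ^+ P) / (1 + r ^+ (P %/ wperm w s j)%N))).
  apply: eq_bigr => j _; rewrite (sum_oppr_exp (w_odd _) (r0 _)).
  rewrite -exprM divnK//.
  by rewrite PE dvdn_mull// /Wperm (bigD1 j)//= dvdn_mulr.
by rewrite prodf_div prodr_const card_ord.
Qed.

End SymmetricGeometricSum.

(** * Closed form of the fermionic integral *)

Section Fermionic.
Variables (R : realType) (p : nat) (K : ultraFieldType R).
Hypotheses (p_prime : prime p) (p_odd : odd p) (K_Cp : is_padic_complex p K).
Implicit Types q x y z c d : K.

Local Notation rho := (p%:R `^ (- (p%:R - 1)^-1) : R).

(** The sum is a small perturbation of 2, a unit because [p] is odd. *)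
Lemma vabs_1D_padic_exp z : vabs z < rho -> vabs (1 + padic_exp z) = 1.
Proof.
move=> zs; have two1 : vabs (2%:R : K) = 1.
  by rewrite (vabs_natr_coprime p_prime (vabs_p K_Cp))// coprimen2.
rewrite -two1; apply: vabs_isolated; rewrite two1.
have -> : 1 + padic_exp z - 2%:R = padic_exp z - 1 by ring.
rewrite (le_lt_trans (vabs_padic_exp_sub1 p_prime K_Cp zs))//.
by rewrite (lt_le_trans zs)// rho_le1.
Qed.

Lemma vabs_1D_padic_expX z a : vabs z < rho -> vabs (1 + padic_exp z ^+ a) = 1.
Proof.
move=> zs; rewrite -(padic_expMn p_prime K_Cp)//.
by rewrite vabs_1D_padic_exp ?vabs_natrM_lt.
Qed.

Lemma padic_exp_1D_neq0 z a : vabs z < rho -> 1 + padic_exp z ^+ a != 0.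
Proof. by move=> zs; rewrite -vabs_gt0 vabs_1D_padic_expX. Qed.

(** The denominators have absolute value 1, and both powers are within [p^(-N)] of 1. *)
Lemma cvg_1D_padic_exp_ratio z a : vabs z < rho ->
  (fun N => (1 + padic_exp z ^+ (a * p ^ N)) / (1 + padic_exp z ^+ (p ^ N)))
    @ \oo --> (1 : K).
Proof.
move=> zs; have pinv0 : 0 <= p%:R^-1 :> R by rewrite invr_ge0.
apply: (@vcvg_squeeze _ _ (fun N => p%:R^-1 ^+ N)) => [|N].
  apply: cvg_expr; rewrite ger0_norm// invf_lt1 ?ltr1n ?ltr0n ?prime_gt1//.
  exact: prime_gt0.
have e0 := padic_exp_1D_neq0 (p ^ N) zs.
rewrite -[X in _ - X](divff e0) -mulrBl vabsM vabsV.
rewrite (vabs_1D_padic_expX _ zs).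
have pow_le b : vabs (padic_exp z ^+ (b * p ^ N) - 1) <= p%:R^-1 ^+ N.
  rewrite -(padic_expMn p_prime K_Cp)//.
  rewrite (le_trans (vabs_padic_exp_sub1 p_prime K_Cp (vabs_natrM_lt _ zs)))//.
  rewrite natrM natrX !vabsM vabsX (vabs_p K_Cp) mulrAC ler_piMl ?exprn_ge0//.
  rewrite mulr_ile1 ?vabs_ge0 ?vabs_natr_le1//.
  by rewrite (le_trans (ltW zs))// rho_le1.
rewrite invr1 mulr1.
have -> : 1 + padic_exp z ^+ (a * p ^ N) - (1 + padic_exp z ^+ (p ^ N)) =
    (padic_exp z ^+ (a * p ^ N) - 1) - (padic_exp z ^+ (1 * p ^ N) - 1).
  by rewrite mul1n; ring.
by rewrite vabsD_le ?vabsN.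
Qed.

(* The binomial theorem turns the defining sums into geometric ones. *)
Lemma fermionic_int_binomial z c d m (f : K -> K) : vabs z < rho ->
  (forall y : nat, f y%:R = c * (1 - d * padic_exp z ^+ y) ^+ m) ->
  fermionic_int p (padic_exp z) f = (1 + padic_exp z) * (c *
    \sum_(i < m.+1) 'C(m, i)%:R * (- d) ^+ i / (1 + padic_exp z ^+ i.+1)).
Proof.
move=> zs fE; set Q := padic_exp z.
have Q0 a : 1 + Q ^+ a != 0 by exact: padic_exp_1D_neq0.
apply: vcvg_limn.
(* An exact identity for every [N], with all dependence on [N] in the last ratio, which tends to
   1. *)
have -> : (fun N => (1 + Q) / (1 + Q ^+ (p ^ N)) *
    \sum_(0 <= y < (p ^ N)%N) f y%:R * (- Q) ^+ y) = (fun N => (1 + Q) * (c *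
    \sum_(i < m.+1) 'C(m, i)%:R * (- d) ^+ i / (1 + Q ^+ i.+1) *
      ((1 + Q ^+ (i.+1 * p ^ N)) / (1 + Q ^+ (p ^ N))))).
  apply/funext => N; rewrite -!mulrA; congr (_ * _).
  under eq_bigr => y _.
    rewrite fE addrC exprD1n -mulrA mulr_suml.
    over.
  rewrite -mulr_sumr mulrCA; congr (_ * _).
  rewrite exchange_big/= mulr_sumr; apply: eq_bigr => i _.
  have pN_odd : odd (p ^ N) by rewrite oddX p_odd orbT.
  have := sum_oppr_exp pN_odd (Q0 i.+1); rewrite -exprM => geo.
  transitivity ((1 + Q ^+ (p ^ N))^-1 * ('C(m, i)%:R * (- d) ^+ i *
      ((1 + Q ^+ (i.+1 * p ^ N)) / (1 + Q ^+ i.+1)))); last by ring.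
  congr (_ * _); rewrite -geo mulr_sumr big_mkord; apply: eq_bigr => y _.
  rewrite -mulNr exprMn [in LHS]exprNn [(- Q) ^+ y]exprNn.
  rewrite [(- Q ^+ i.+1) ^+ y]exprNn.
  rewrite [(- d) ^+ i]exprNn -!exprM mulSn exprD [(i * y)%N]mulnC -mulr_natl.
  by ring.
apply: vcvgMl; apply: vcvgMl; apply: vcvg_sum => i.
rewrite -[X in _ --> X]mulr1; apply: vcvgMl.
exact: cvg_1D_padic_exp_ratio.
Qed.

(** * Closed form of the coefficients of the symmetric sum *)

Section SymmetricClosedForm.
Variables (n : nat) (w : 'I_n.+1 -> nat) (q x : K).
Hypotheses (w_gt0 : forall j, (0 < w j)%N) (w_odd : forall j, odd (w j)).
Hypotheses (q_neq1 : q != 1) (q_near1 : vabs (1 - q) < rho).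
Hypothesis (x_le1 : vabs x <= 1).

Let L := padic_log q.
Let P := (\prod_j w j)%N.

Let qs : vabs (q - 1) < rho. Proof. by rewrite vabs_distC. Qed.

Let Ls : vabs L < rho. Proof. by rewrite (vabs_padic_log p_prime K_Cp). Qed.

Let L0 : L != 0.
Proof.
by rewrite -vabs_gt0 (vabs_padic_log p_prime K_Cp)// vabs_gt0 subr_eq0.
Qed.

Let qpow_nat a : qpow q a%:R = padic_exp L ^+ a.
Proof. exact: (padic_expMn p_prime K_Cp). Qed.

(** With [Q = qpow q a], the power [qpow Q 2] is defined through [padic_log Q]; [padic_expK]
    identifies it with [Q ^+ 2], and [Q != 1] permits the division. *)
Let qnum2 a : (0 < a)%N -> qnum (qpow q a%:R) 2%:R = 1 + qpow q a%:R.
Proof.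
move=> a0; have aLs := vabs_natrM_lt a Ls.
have e1 : padic_exp (a%:R * L) != 1.
  rewrite (padic_exp_neq1 p_prime K_Cp)// mulf_neq0//.
  by rewrite (natr_neq0 p_prime (vabs_p K_Cp)).
rewrite /qnum /qpow (padic_expK p_prime K_Cp)// (padic_expMn p_prime K_Cp)//.
rewrite -/L; move: (padic_exp _) e1 => e e1; field.
by rewrite subr_eq0 eq_sym.
Qed.

Lemma sym_fpsE (s : 'S_n.+1) m : sym_fps p w s q x m =
  (1 - q)^-1 ^+ m / m`!%:R * \sum_(i < m.+1)
    'C(m, i)%:R * (- padic_exp (P%:R * x * L)) ^+ i *
    ((1 + padic_exp L ^+ i.+1 ^+ P) ^+ n /
     \prod_j (1 + padic_exp L ^+ i.+1 ^+ (P %/ w j)%N)).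
Proof.
set g := padic_exp (P%:R * x * L); set E := padic_exp L.
set W := Wperm w s; set c := (1 - q)^-1 ^+ m / m`!%:R.
have W0 : (0 < W)%N by rewrite prodn_gt0// => j; exact: w_gt0.
have gs : vabs (P%:R * x * L) < rho.
  rewrite vabsM (le_lt_trans _ Ls)// ler_piMl ?vabs_ge0// vabsM.
  by rewrite mulr_ile1 ?vabs_ge0 ?vabs_natr_le1.
(* At a natural number [y] the integrand is [c * (1 - g * E ^+ b * (E ^+ W) ^+ y) ^+ m], the form
   required by [fermionic_int_binomial]. *)
have int b : fermionic_int p (qpow q W%:R) (fun y => exp_fps
    (qnum q (W%:R * y + P%:R * x + b%:R)) m) = (1 + E ^+ W) * (c *
    \sum_(i < m.+1) 'C(m, i)%:R * (- (g * E ^+ b)) ^+ i / (1 + E ^+ W ^+ i.+1)).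
  have := @fermionic_int_binomial (W%:R * L) c (g * E ^+ b) m.
  rewrite (padic_expMn p_prime K_Cp)// qpow_nat.
  apply; first exact: vabs_natrM_lt.
  move=> y; rewrite /exp_fps /qnum /qpow.
  have -> : (W%:R * y%:R + P%:R * x + b%:R) * L =
      (W * y + b)%:R * L + P%:R * x * L by rewrite natrD natrM; ring.
  rewrite (padic_expD p_prime K_Cp) ?vabs_natrM_lt//.
  rewrite !(padic_expMn p_prime K_Cp)//.
  rewrite exprMn exprD exprM -/g -/E /c.
  by rewrite [_ * g]mulrC [E ^+ W ^+ y * _]mulrC mulrA; ring.
rewrite /sym_fps /fermionic_int_fps /= qnum2//.
under eq_bigr do rewrite -/P -/W int.
have EW0 : 1 + E ^+ W != 0 by exact: padic_exp_1D_neq0.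
transitivity (c * \sum_(k : {dffun forall j : 'I_n, 'I_(wperm w s j)})
    \sum_(i < m.+1) 'C(m, i)%:R * (- g) ^+ i * ((-1) ^+ (\sum_(j < n) k j)%N *
      E ^+ i.+1 ^+ (w (s ord_max) * Kperm w s (fun j => k j))%N /
      (1 + E ^+ i.+1 ^+ W))).
  rewrite !mulr_sumr; apply: eq_bigr => k _.
  rewrite !qpow_nat -/E; set b := (w _ * _)%N; set eps := (-1) ^+ _.
  (* The prefactor [1 + E ^+ W] of the integral cancels the inverse of the 2-number. *)
  rewrite [LHS](_ : _ = c * (eps * E ^+ b * \sum_(i < m.+1) 'C(m, i)%:R *
      (- (g * E ^+ b)) ^+ i / (1 + E ^+ W ^+ i.+1))); last by field.
  congr (_ * _); rewrite mulr_sumr; apply: eq_bigr => i _.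
  (* The outer [E ^+ b] joins the [i] copies from the binomial term, so the ratio becomes
     [E ^+ i.+1]. *)
  rewrite -mulNr [in LHS]exprMn -!exprM [(i.+1 * b)%N]mulnC [(i.+1 * W)%N]mulnC.
  rewrite [(b * i.+1)%N]mulnS exprD; ring.
rewrite exchange_big/=; congr (_ * _); apply: eq_bigr => i _.
rewrite -mulr_sumr sym_geometric_sum// => a.
by rewrite -exprM; exact: padic_exp_1D_neq0.
Qed.

End SymmetricClosedForm.
End Fermionic.

(** * Invariance under permutations *)

Theorem theorem2p1 (R : realType) (p : nat) (p_prime : prime p)
  (p_odd : odd p) (K : ultraFieldType R)
  (K_Cp : is_padic_complex p K) (q x : K) (q_neq1 : q != 1)
  (q_near1 : vabs (1 - q) < p%:R `^ (- (p%:R - 1)^-1))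
  (x_Zp : padic_int x) (n : nat) (w : 'I_n.+1 -> nat)
  (w_gt0 : forall j, (0 < w j)%N) (w_odd : forall j, w j = 1 %[mod 2])
  (s s' : 'S_n.+1) :
  sym_fps p w s q x = sym_fps p w s' q x.
Proof.
have w_odd' j : odd (w j) by have := w_odd j; rewrite !modn2; case: odd.
(* The closed form contains no permutation, so both sides become the same expression. *)
apply/funext => m; rewrite !(sym_fpsE p_prime p_odd K_Cp)//; exact: x_Zp.2.
Qed.
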